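(* Let $G$ be a finite simple graph that contains none of $P_2+P_3$, $\overline{P_2+P_3}$, $K_2+K_3$ as an induced subgraph, and suppose $G$ contains an induced subgraph isomorphic to $H_1$. Then $\theta(G)\leq \alpha(G)+3$.
   Context: $P_2+P_3$ is the disjoint union of a two-vertex path and a three-vertex path, $\overline{P_2+P_3}$ its complement; $K_2+K_3$ is the disjoint union of an edge and a triangle. $H_1$ is the 7-vertex graph with vertices $v_1,v_2,v_3,v_4,a_1,a_2,a_3$ and edges $v_1v_2,v_2v_3,v_3v_4,v_4v_1$ (a 4-cycle), $a_1v_1,a_2v_2,a_3v_3$, and $a_1a_2,a_2a_3,a_1a_3$ (a triangle), and no other edges. $\alpha(G)$ is the stability number of $G$ and $\theta(G)$ is the clique covering number (minimum number of cliques needed to cover $V(G)$). *)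

(* Defs.v *)
From mathcomp Require Import all_boot.

Set Implicit Arguments.
Unset Strict Implicit.
Unset Printing Implicit Defensive.

Record sgraph := SGraph {
  vertex :> finType;
  adj : rel vertex;
  adj_sym : symmetric adj;
  adj_irr : irreflexive adj
}.

Section Constructions.
Variables G H : sgraph.

Definition compl_adj : rel G := fun x y => (x != y) && ~~ adj x y.
Lemma compl_adj_sym : symmetric compl_adj.
Proof. by move=> x y; rewrite /compl_adj eq_sym adj_sym. Qed.
Lemma compl_adj_irr : irreflexive compl_adj.
Proof. by move=> x; rewrite /compl_adj eqxx. Qed.
Definition compl : sgraph := SGraph compl_adj_sym compl_adj_irr.

Definition disjoint_union_adj : rel (G + H)%type := fun x y =>
  match x, y with
  | inl a, inl b => adj a b
  | inr a, inr b => adj a b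
  | _, _ => false
  end.
Lemma disjoint_union_adj_sym : symmetric disjoint_union_adj.
Proof. by case=> x [] y //=; exact: adj_sym. Qed.
Lemma disjoint_union_adj_irr : irreflexive disjoint_union_adj.
Proof. by case=> x /=; exact: adj_irr. Qed.
Definition disjoint_union : sgraph :=
  SGraph disjoint_union_adj_sym disjoint_union_adj_irr.

Variable S : {set G}.
Definition induced_adj : rel {x : G | x \in S} :=
  fun x y => adj (val x) (val y).
Lemma induced_adj_sym : symmetric induced_adj.
Proof. by move=> x y; exact: adj_sym. Qed.
Lemma induced_adj_irr : irreflexive induced_adj.
Proof. by move=> x; exact: adj_irr. Qed.
Definition induced : sgraph := SGraph induced_adj_sym induced_adj_irr.

End Constructions.

Definition isomorphic (G H : sgraph) : Prop :=
  exists2 f : G -> H, bijective f & forall x y, adj (f x) (f y) = adj x y.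

Definition has_induced (G H : sgraph) : Prop :=
  exists S : {set G}, isomorphic (induced S) H.

Definition path_adj (n : nat) : rel 'I_n :=
  fun i j => (i.+1 == j :> nat) || (j.+1 == i :> nat).
Lemma path_adj_sym n : symmetric (@path_adj n).
Proof. by move=> i j; rewrite /path_adj orbC. Qed.
Lemma path_adj_irr n : irreflexive (@path_adj n).
Proof. by move=> i; rewrite /path_adj orbb gtn_eqF. Qed.
Definition path_graph (n : nat) : sgraph :=
  SGraph (@path_adj_sym n) (@path_adj_irr n).

Definition complete_adj (n : nat) : rel 'I_n := fun i j => i != j.
Lemma complete_adj_sym n : symmetric (@complete_adj n).
Proof. by move=> i j; rewrite /complete_adj eq_sym. Qed.
Lemma complete_adj_irr n : irreflexive (@complete_adj n).
Proof. by move=> i; rewrite /complete_adj eqxx. Qed.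
Definition complete_graph (n : nat) : sgraph :=
  SGraph (@complete_adj_sym n) (@complete_adj_irr n).

(* Vertices 0, 1, 2, 3 stand for v_1, v_2, v_3, v_4 and 4, 5, 6 for
   a_1, a_2, a_3. *)
Definition H1_edges : seq (nat * nat) :=
  [:: (0, 1); (1, 2); (2, 3); (3, 0);
      (4, 0); (5, 1); (6, 2);
      (4, 5); (5, 6); (4, 6)].
Definition H1_adj : rel 'I_7 := fun i j =>
  ((i : nat, j : nat) \in H1_edges) || ((j : nat, i : nat) \in H1_edges).
Lemma H1_adj_sym : symmetric H1_adj.
Proof. by move=> i j; rewrite /H1_adj orbC. Qed.
Lemma H1_adj_irr : irreflexive H1_adj.
Proof. by case; do 7?[case=> //]. Qed.
Definition H1 : sgraph := SGraph H1_adj_sym H1_adj_irr.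

Definition P2_P3 : sgraph := disjoint_union (path_graph 2) (path_graph 3).
Definition K2_K3 : sgraph :=
  disjoint_union (complete_graph 2) (complete_graph 3).

Section Invariants.
Variable G : sgraph.

Definition stable (S : {set G}) : bool :=
  [forall x in S, forall y in S, ~~ adj x y].
Definition stability_number : nat := \max_(S : {set G} | stable S) #|S|.

Definition clique (S : {set G}) : bool :=
  [forall x in S, forall y in S, (x != y) ==> adj x y].
Definition clique_cover (P : {set {set G}}) : bool :=
  [forall K in P, clique K] && (cover P == [set: G]).

Definition singletons : {set {set G}} := [set [set x] | x in G].
Lemma clique_cover_singletons : clique_cover singletons.
Proof.
apply/andP; split.
  apply/forall_inP=> _ /imsetP[x _ ->].
  apply/forall_inP=> y /set1P->; apply/forall_inP=> z /set1P->.
  by rewrite eqxx.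
apply/eqP/setP=> x; rewrite inE; apply/bigcupP.
by exists [set x]; [exact: imset_f | exact: set11].
Qed.

(* The starting point of the arg min is admissible by the preceding lemma,
   so this is the least cardinality of a clique cover. *)
Definition clique_cover_number : nat :=
  #|[arg min_(P < singletons | clique_cover P) #|P| ]|.

End Invariants.

(* Main.v *)
Require Import Defs.
From mathcomp Require Import all_boot.

(** Fix an induced copy of [H1] and sort the other vertices by their trace on
    it, the vector of their adjacencies to v1, ..., v4, a1, a2, a3.  Only 18
    traces are compatible with the three forbidden graphs.  Let W be the set of
    vertices whose trace is one of {}, {v3, a1}, {v1, a3} and {v1, v3, a2}.  In
    W a vertex of empty trace has at most one neighbour, the other three classes
    are stable and joined by matchings, and a vertex of trace {v1, a3} sees one
    of any two vertices of trace {v3, a1}.  Remove simplicial vertices from W as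
    long as there are any.  In what is left, every vertex has a neighbour in
    both of the other classes, so that the three classes have the same size,
    which is at most 2, and a nonempty remainder is covered by three edges of a
    6-cycle.  This gives theta(W) = alpha(W).  Since v2 and v4 are not adjacent
    and have no neighbour in W, alpha(G) >= alpha(W) + 2.  Finally the vertices
    outside W are covered by 5 cliques, each a union of trace classes and
    vertices of [H1]: two vertices in the same clique are adjacent because
    otherwise they would create a forbidden graph together with [H1]. *)

Set Implicit Arguments.
Unset Strict Implicit.
Unset Printing Implicit Defensive.

Section CliqueCovers.
Variable G : sgraph.
Implicit Types (A B K U W X Y : {set G}) (x y z : G).

Lemma adj_neq x y : adj x y -> x != y.
Proof. by apply: contraTneq => ->; rewrite adj_irr. Qed.

Lemma cliqueP K :
  reflect {in K &, forall x y, x != y -> adj x y} (clique K).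
Proof.
apply: (iffP forall_inP) => [cK x y xK yK|cK x xK].
  by move/(_ x xK)/forall_inP/(_ y yK)/implyP: cK.
by apply/forall_inP=> y yK; apply/implyP; apply: cK.
Qed.

Lemma stableP X : reflect {in X &, forall x y, ~~ adj x y} (stable X).
Proof.
apply: (iffP forall_inP) => [sX x y xX yX|sX x xX].
  by move/(_ x xX)/forall_inP/(_ y yX): sX.
by apply/forall_inP=> y yX; apply: sX.
Qed.

Lemma clique2 x y : adj x y -> clique [set x; y].
Proof.
move=> xy; apply/cliqueP=> u v /set2P[]-> /set2P[]->; rewrite ?eqxx //.
by rewrite adj_sym.
Qed.

Lemma stable0 : stable (set0 : {set G}).
Proof. by apply/stableP=> x y; rewrite inE. Qed.

Lemma stable1 x : stable [set x].
Proof. by apply/stableP=> u v /set1P-> /set1P->; rewrite adj_irr. Qed.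

Lemma stableU X Y : stable X -> stable Y ->
  {in X & Y, forall x y, ~~ adj x y} -> stable (X :|: Y).
Proof.
move=> /stableP sX /stableP sY sXY.
apply/stableP=> x y /setUP[] xXY /setUP[] yXY.
- exact: sX.
- exact: sXY.
- by rewrite adj_sym sXY.
exact: sY.
Qed.

Lemma stable2 x y : ~~ adj x y -> stable [set x; y].
Proof.
by move=> xy; apply: stableU (stable1 x) (stable1 y) _ => u v /set1P-> /set1P->.
Qed.

Lemma leq_stability_number X : stable X -> #|X| <= stability_number G.
Proof. by move=> sX; rewrite /stability_number (bigmax_sup X). Qed.

Definition clique_coverable n A : Prop := exists s : seq {set G},
  [/\ size s <= n, all (@clique G) s &
      {in A, forall x, has (fun K => x \in K) s}].

Lemma clique_coverable0 : clique_coverable 0 set0.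
Proof. by exists [::]; split=> // x; rewrite inE. Qed.

Lemma clique_coverable1 K : clique K -> clique_coverable 1 K.
Proof.
by move=> cK; exists [:: K]; split; rewrite /= ?cK // => x xK; rewrite /= xK.
Qed.

Lemma clique_coverableS n A B :
  A \subset B -> clique_coverable n B -> clique_coverable n A.
Proof.
by move=> /subsetP AB [s [sn sC sB]]; exists s; split=> // x /AB /sB.
Qed.

Lemma clique_coverableU m n A B : clique_coverable m A ->
  clique_coverable n B -> clique_coverable (m + n) (A :|: B).
Proof.
move=> [s [sm sC sA]] [t [tn tC tB]]; exists (s ++ t).
split; rewrite ?size_cat ?leq_add ?all_cat ?sC // => x.
by rewrite has_cat => /setUP[/sA->|/tB->]; rewrite ?orbT.
Qed.

Lemma clique_cover_number_le n :
  clique_coverable n [set: G] -> clique_cover_number G <= n.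
Proof.
case=> s [sn sC sG]; rewrite /clique_cover_number.
case: arg_minnP => [|P _ minP]; first exact: clique_cover_singletons.
apply: leq_trans (minP [set K in s] _) _; last first.
  by rewrite cardsE (leq_trans (card_size s)).
apply/andP; split.
  by apply/forall_inP=> K; rewrite inE => /(allP sC).
apply/eqP/setP=> x; rewrite inE; apply/bigcupP.
by have /hasP[K Ks xK] := sG x (in_setT x); exists K; rewrite ?inE.
Qed.

Definition theta_le_alpha W : Prop := exists X,
  [/\ X \subset W, stable X & clique_coverable #|X| W].

Definition closed_nbh W x : {set G} := [set y in W | (y == x) || adj x y].

Definition simplicial W x : bool := clique (closed_nbh W x).

Lemma non_simplicialP W x : ~~ simplicial W x -> exists y z,
  [/\ y \in W, z \in W & [/\ adj x y, adj x z, y != z & ~~ adj y z]].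
Proof.
case/forall_inPn=> y; rewrite inE => /andP[yW xy] /forall_inPn[z].
rewrite inE => /andP[zW xz]; rewrite negb_imply => /andP[yz nyz].
have {}xy : adj x y.
  by case/predU1P: xy xz nyz yz => // -> /predU1P[->|->//]; rewrite eqxx.
exists y, z; split=> //; split=> //.
by case/predU1P: xz nyz => // ->; rewrite adj_sym xy.
Qed.

Lemma theta_le_alpha_simplicial W x : x \in W -> simplicial W x ->
  theta_le_alpha (W :\: closed_nbh W x) -> theta_le_alpha W.
Proof.
move=> xW Wx [X [/subsetP XW sX covX]].
have xX y : y \in X -> (y != x) && ~~ adj x y.
  by move/XW; rewrite !inE; case: (y \in W); rewrite ?andbF // andbT negb_or.
exists (x |: X); split.
- apply/subsetP=> y /setU1P[->//|/XW].
  by rewrite inE => /andP[].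
- by apply: stableU (stable1 x) sX _ => _ y /set1P-> /xX/andP[].
have -> : #|x |: X| = 1 + #|X|.
  by rewrite cardsU1; case: (boolP (x \in X)) => // /xX; rewrite eqxx.
apply: clique_coverableS (clique_coverableU (clique_coverable1 Wx) covX).
by apply/subsetP=> y yW; rewrite !in_setU in_setD yW andbT orbN.
Qed.

Lemma simplicial_elimination W :
  (forall U, U \subset W -> {in U, forall x, ~~ simplicial U x} ->
    theta_le_alpha U) ->
  theta_le_alpha W.
Proof.
have [n] := ubnP #|W|; elim: n W => // n IHn W; rewrite ltnS => leWn redW.
have [/exists_inP[x xW Wx]|/exists_inPn] :=
  boolP [exists x in W, simplicial W x].
  apply: theta_le_alpha_simplicial (xW) Wx _; apply: IHn => [|U UW].
    apply: leq_trans leWn; apply/proper_card/properP.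
    split; first exact: subsetDl.
    by exists x; rewrite // !inE xW eqxx.
  by apply: redW; apply: subset_trans UW (subsetDl _ _).
exact: redW.
Qed.

End CliqueCovers.

Section MatchingColorings.
Variables (G : sgraph) (K : eqType) (color : G -> K) (W : {set G}).

Definition color_class k : {set G} := [set x in W | color x == k].

Definition matching_coloring : Prop :=
  {in W &, forall x y, adj x y -> color x != color y} /\
  {in W & &, forall x y z, adj x y -> adj x z -> y != z -> color y != color z}.

Hypothesis colorM : matching_coloring.

Lemma matching_coloring_nadj x y z : x \in W -> y \in W -> z \in W ->
  adj x y -> color y = color z -> y != z -> ~~ adj x z.
Proof.
move=> xW yW zW xy cyz; apply: contra_neqN => xz; apply: contra_eq cyz.
exact: colorM.2 xW yW zW xy xz.
Qed.

Variable ks : seq K.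
Hypothesis ks3 : size ks <= 3.
Hypothesis colorW : {in W, forall x, color x \in ks}.
Hypothesis non_simplicialW : {in W, forall x, ~~ simplicial W x}.

Lemma mem_color3 x y z k : x \in W -> y \in W -> z \in W -> k \in ks ->
  uniq [:: color x; color y; color z] -> k \in [:: color x; color y; color z].
Proof.
move=> xW yW zW kK uxyz.
have sub_ks : {subset [:: color x; color y; color z] <= ks}.
  by move=> l; rewrite !inE => /or3P[] /eqP->; apply: colorW.
by have [_ ->] := uniq_min_size uxyz sub_ks ks3.
Qed.

Lemma non_simplicial_nbr x k : x \in W -> k \in ks -> k != color x ->
  exists y, [/\ y \in W, adj x y & color y = k].
Proof.
move=> xW kK kx.
have [y [z [yW zW [xy xz yz _]]]] := non_simplicialP (non_simplicialW xW).
have: k \in [:: color x; color y; color z].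
  apply: mem_color3 => //=.
  by rewrite !inE negb_or (colorM.1 x y) ?(colorM.1 x z) ?(colorM.2 x y z).
by rewrite !inE (negbTE kx) /= => /orP[] /eqP ->; [exists y | exists z].
Qed.

Lemma non_simplicial_twin x y : x \in W -> y \in W ->
  color x != color y -> ~~ adj x y ->
  exists z, [/\ z \in W, adj x z, color y = color z & y != z].
Proof.
move=> xW yW; rewrite eq_sym => cyx nxy.
have [z [zW xz cz]] := non_simplicial_nbr xW (colorW yW) cyx.
by exists z; split=> //; apply: contraNneq nxy => ->.
Qed.

Lemma leq_color_class k l : k \in ks -> l \in ks ->
  #|color_class k| <= #|color_class l|.
Proof.
move=> kK lK; have [-> //|kl] := eqVneq k l.
pose nbr x := odflt x [pick y in W | adj x y && (color y == l)].
have nbrP x : x \in color_class k ->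
    [/\ nbr x \in W, adj x (nbr x) & color (nbr x) = l].
  rewrite inE => /andP[xW /eqP cx]; rewrite /nbr.
  case: pickP => [y /and3P[yW xy /eqP cy] //|].
  have [|y [yW xy cy]] := non_simplicial_nbr xW lK; first by rewrite cx eq_sym.
  by move/(_ y); rewrite yW xy cy eqxx.
rewrite -(@card_in_imset _ _ nbr) => [|x y xk yk nbr_xy].
  apply/subset_leq_card/subsetP=> _ /imsetP[x /nbrP[nW _ cn] ->].
  by rewrite inE nW cn /=.
have [nW xn cn] := nbrP x xk; have [_ yn _] := nbrP y yk.
move: xk yk; rewrite !inE => /andP[xW /eqP cx] /andP[yW /eqP cy].
apply/eqP/negPn/negP=> xy.
have := matching_coloring_nadj nW xW yW; rewrite adj_sym xn cx cy nbr_xy.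
by move=> /(_ isT erefl xy); rewrite adj_sym yn.
Qed.

Variables a c : K.
Hypotheses (aK : a \in ks) (cK : c \in ks) (ac : a != c).
Hypothesis splitW : {in color_class a & color_class a & color_class c,
  forall x y z, x != y -> adj z x || adj z y}.

Lemma color_class_le2 k : k \in ks -> #|color_class k| <= 2.
Proof.
move=> kK; apply: leq_trans (leq_color_class kK aK) _; rewrite leqNgt.
apply/card_gt2P=> -[x [y [t [[xa ya ta] [xy yt tx]]]]].
have color_a u : u \in color_class a -> u \in W /\ color u = a.
  by rewrite inE => /andP[uW /eqP].
have [[xW cx] [yW cy] [tW ct]] :=
  And3 (color_a x xa) (color_a y ya) (color_a t ta).
have [|z [zW _ cz]] := non_simplicial_nbr xW cK; first by rewrite cx eq_sym.
have zc : z \in color_class c by rewrite inE zW cz /=.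
have nadj u v : u \in W -> v \in W -> color u = a -> color v = a -> u != v ->
    ~~ (adj z u && adj z v).
  move=> uW vW cu cv uv; apply/negP=> /andP[zu]; apply/negP.
  by apply: (matching_coloring_nadj zW uW); rewrite ?cu.
have := splitW xa ya zc xy; have := nadj x y xW yW cx cy xy.
have := splitW ya ta zc yt; have := nadj y t yW tW cy ct yt.
have := splitW ta xa zc tx; have := nadj t x tW xW ct cx tx.
by case: (adj z x); case: (adj z y); case: (adj z t).
Qed.

Lemma color_class2 x y z : x \in W -> y \in W -> z \in W -> x != y ->
  color x = color y -> color z = color x -> z \in [set x; y].
Proof.
move=> xW yW zW xy cxy czx.
suff -> : [set x; y] = color_class (color x) by rewrite inE zW czx /=.
apply/eqP; rewrite eqEcard cards2 xy color_class_le2 ?colorW // andbT.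
by apply/subsetP=> u; rewrite !inE => /orP[] /eqP->; rewrite ?xW ?yW ?cxy /=.
Qed.

(* The edges [x z], [y z'] and [y' x'] alternate on a 6-cycle
   [x z y' x' z' y]. *)
Lemma theta_le_alpha_non_simplicial : theta_le_alpha W.
Proof.
have [->|[x xW]] := set_0Vmem W.
  exists set0; split; rewrite ?sub0set ?stable0 // cards0.
  exact: clique_coverable0.
have [y [z [yW zW [xy xz yz nyz]]]] := non_simplicialP (non_simplicialW xW).
have cxy := colorM.1 x y xW yW xy; have cxz := colorM.1 x z xW zW xz.
have cyz := colorM.2 x y z xW yW zW xy xz yz.
have [z' [z'W yz' cz' nzz']] := non_simplicial_twin yW zW cyz nyz.
have [y' [y'W zy' cy' nyy']] : exists y',
    [/\ y' \in W, adj z y', color y = color y' & y != y'].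
  by apply: non_simplicial_twin; rewrite // 1?adj_sym // eq_sym.
have nxy' := matching_coloring_nadj xW yW y'W xy cy' nyy'.
have nxz' := matching_coloring_nadj xW zW z'W xz cz' nzz'.
have ny'z' : ~~ adj y' z'.
  by rewrite adj_sym (matching_coloring_nadj z'W yW) // adj_sym.
have [x' [x'W y'x' cx' nxx']] : exists x',
    [/\ x' \in W, adj y' x', color x = color x' & x != x'].
  by apply: non_simplicial_twin; rewrite // -?cy' 1?adj_sym // eq_sym.
exists [set x; y'; z']; split.
- by apply/subsetP=> u; rewrite !inE => /orP[/orP[]|] /eqP->.
- by apply: stableU (stable2 nxy') (stable1 z') _ => u v /set2P[]-> /set1P->.
have -> : #|[set x; y'; z']| = 1 + 1 + 1.
  rewrite -setUA cardsU1 cards2 !inE negb_or.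
  have neqc u v : color u != color v -> u != v by apply: contraNneq => ->.
  by rewrite !neqc -?cy' -?cz'.
apply: (@clique_coverableS _ _ _ ([set x; z] :|: [set y; z'] :|: [set y'; x'])).
  apply/subsetP=> w wW.
  have: color w \in [:: color x; color y; color z].
    by apply: mem_color3; rewrite ?colorW //= !inE negb_or cxy cxz cyz.
  rewrite !inE => /or3P[] /eqP cw.
  - have /set2P[->|->] := color_class2 xW x'W wW nxx' cx' cw;
      by rewrite eqxx ?orbT.
  - have /set2P[->|->] := color_class2 yW y'W wW nyy' cy' cw;
      by rewrite eqxx ?orbT.
  have /set2P[->|->] := color_class2 zW z'W wW nzz' cz' cw;
    by rewrite eqxx ?orbT.
by do 2?apply: clique_coverableU; apply/clique_coverable1/clique2.
Qed.

End MatchingColorings.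

Section AdjacencyRows.
Variables (T : Type) (e : rel T).

(* The new vertex comes first, so that adding vertices to a sequence puts rows
   in front of the existing ones. *)
Fixpoint adj_rows (s : seq T) : seq (seq bool) :=
  if s is x :: s' then map (e x) s' :: adj_rows s' else [::].

Lemma size_adj_rows s : size (adj_rows s) = size s.
Proof. by elim: s => //= x s ->. Qed.

Lemma nth_adj_rows x0 s i j : i < j < size s ->
  nth false (nth [::] (adj_rows s) i) (j - i.+1) = e (nth x0 s i) (nth x0 s j).
Proof.
elim: s i j => [|x s IHs] [|i] [|j] //= ltj; first by rewrite andbF in ltj.
  by rewrite subn1 (nth_map x0).
by rewrite subSS IHs.
Qed.

End AdjacencyRows.

Lemma map_adj_rows (T T' : eqType) (e : rel T) (e' : rel T') (f : T -> T') s :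
  {in s &, forall x y, e' (f x) (f y) = e x y} ->
  adj_rows e' (map f s) = adj_rows e s.
Proof.
elim: s => //= x s IHs ef; rewrite IHs => [|y z ys zs]; last first.
  by rewrite ef // inE (ys, zs) orbT.
rewrite -map_comp; congr (_ :: _); apply/eq_in_map=> y ys.
by rewrite /= ef // inE ?eqxx ?ys ?orbT.
Qed.

Definition row_edge (rows : seq (seq bool)) : rel nat := fun i j =>
  if i < j then nth false (nth [::] rows i) (j - i.+1)
  else if j < i then nth false (nth [::] rows j) (i - j.+1) else false.

Fixpoint embeddings (rows pattern : seq (seq bool)) : seq (seq nat) :=
  if pattern is r :: pattern' then
    [seq i :: s | s <- embeddings rows pattern',
                  i <- [seq i <- iota 0 (size rows) |
                         (i \notin s) && (map (row_edge rows i) s == r)]]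
  else [:: [::]].

Lemma embeddingsP rows pattern s : s \in embeddings rows pattern ->
  [/\ uniq s, {subset s <= gtn (size rows)}
    & adj_rows (row_edge rows) s = pattern].
Proof.
elim: pattern s => [|r pattern IHp] s /=; first by rewrite inE => /eqP->.
case/allpairsPdep=> t [i [/IHp[ut subt <-]]].
rewrite mem_filter mem_iota => /andP[/andP[it /eqP <-] /= lti] ->.
split=> //=; first by rewrite it.
by move=> j /predU1P[->|/subt].
Qed.

Definition contains_rows rows pattern := embeddings rows pattern != [::].

Lemma row_edge_adj_rows (G : sgraph) x0 (s : seq G) i j :
  i < size s -> j < size s ->
  row_edge (adj_rows (@adj G) s) i j = adj (nth x0 s i) (nth x0 s j).
Proof.
move=> lti ltj; rewrite /row_edge; case: ltngtP => [ij|ji|<-].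
- by rewrite (nth_adj_rows _ x0) ?ij.
- by rewrite (nth_adj_rows _ x0) ?ji // adj_sym.
by rewrite adj_irr.
Qed.

Lemma has_induced_inj (G H : sgraph) (f : H -> G) :
  injective f -> (forall x y, adj (f x) (f y) = adj x y) -> has_induced G H.
Proof.
move=> f_inj f_adj; exists (f @: H).
pose g (x : H) : induced (f @: H) := exist _ (f x) (imset_f f (erefl true)).
have g_inj : injective g by move=> x y /(congr1 val) /f_inj.
have [|g' gK g'K] := inj_card_bij g_inj.
  by rewrite card_sig (card_imset _ f_inj).
exists g'; first by exists g.
by move=> x y; rewrite -f_adj -{2}(g'K x) -{2}(g'K y).
Qed.

Lemma has_inducedP (G H : sgraph) (t : seq H) :
  uniq t -> (forall x, x \in t) ->
  has_induced G H <->
  exists2 s : seq G, uniq s & adj_rows (@adj G) s = adj_rows (@adj H) t.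
Proof.
move=> ut tH; split=> [[S [f [g fK gK] f_adj]]|[s us Est]].
  exists (map (val \o g) t).
    by rewrite map_inj_uniq // => x y /val_inj /(can_inj gK).
  by apply: map_adj_rows => x y _ _; rewrite -{2}(gK x) -{2}(gK y) f_adj.
have Esize : size s = size t.
  by rewrite -(size_adj_rows (@adj G)) Est size_adj_rows.
have lt_index x : index x t < size s by rewrite Esize index_mem.
case: s us Est Esize lt_index => [|x0 s] us Est Esize lt_index.
  have H_empty (x : H) : False by have := lt_index x.
  by apply: (@has_induced_inj G H (fun x => match H_empty x with end)) => x;
    case: (H_empty x).
apply: (@has_induced_inj G H (fun x => nth x0 (x0 :: s) (index x t))) => x y.
  by move/eqP; rewrite nth_uniq // => /eqP /index_inj; apply.
rewrite -row_edge_adj_rows // Est (row_edge_adj_rows x) -?Esize //.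
by rewrite !nth_index.
Qed.

Lemma contains_adj_rows (G : sgraph) (s : seq G) pattern :
  uniq s -> contains_rows (adj_rows (@adj G) s) pattern ->
  exists2 u : seq G, uniq u & adj_rows (@adj G) u = pattern.
Proof.
move=> us; rewrite /contains_rows; case E: (embeddings _ _) => [//|w ?] _.
have /embeddingsP[uw] : w \in embeddings (adj_rows (@adj G) s) pattern.
  by rewrite E mem_head.
rewrite size_adj_rows; case: s us {E} => [|x0 s] us sub_w <-.
  by exists [::] => //; case: w {uw} sub_w => // i w /(_ i (mem_head _ _)).
exists (map (nth x0 (x0 :: s)) w).
  rewrite map_inj_in_uniq // => i j /sub_w lti /sub_w ltj /eqP.
  by rewrite nth_uniq // => /eqP.
apply: map_adj_rows => i j /sub_w lti /sub_w ltj.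
by rewrite (row_edge_adj_rows x0).
Qed.

Definition P2_P3_vertices : seq P2_P3 :=
  [:: inl (@Ordinal 2 0 isT); inl (@Ordinal 2 1 isT);
      inr (@Ordinal 3 0 isT); inr (@Ordinal 3 1 isT); inr (@Ordinal 3 2 isT)].

Definition H1_vertices : seq H1 :=
  [:: @Ordinal 7 0 isT; @Ordinal 7 1 isT; @Ordinal 7 2 isT; @Ordinal 7 3 isT;
      @Ordinal 7 4 isT; @Ordinal 7 5 isT; @Ordinal 7 6 isT].

Lemma mem_P2_P3_vertices x : x \in P2_P3_vertices.
Proof. by case: x => [] [[|[|[|]]]]. Qed.

Lemma mem_H1_vertices x : x \in H1_vertices.
Proof. by case: x; do 7?[case=> //]. Qed.

Definition H1_rows := adj_rows (@adj H1) H1_vertices.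

(* The vertex type of [P2_P3] also carries its complement and [K2_K3]. *)
Definition free_rows (rows : seq (seq bool)) : bool :=
  ~~ has (contains_rows rows)
    [:: adj_rows (@adj P2_P3) P2_P3_vertices;
        adj_rows (@adj (compl P2_P3)) P2_P3_vertices;
        adj_rows (@adj K2_K3) P2_P3_vertices].

(* [x], [y] and [z] are further vertices: [r], [s] and [t] are the rows of their
   adjacencies to the vertices of [H1]. *)
Definition free_vertex r := free_rows (r :: H1_rows).
Definition free_pair r s (xy : bool) := free_rows [:: xy :: r, s & H1_rows].
Definition free_triple r s t (xy xz yz : bool) :=
  free_rows [:: [:: xy, xz & r], yz :: s, t & H1_rows].

(* As in [H1], the indices 0, 1, 2, 3 stand for v1, v2, v3, v4 and 4, 5, 6 for
   a1, a2, a3. *)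
Definition H1_row (l : seq nat) : seq bool := [seq i \in l | i <- iota 0 7].

Definition matching_rows : seq (seq bool) :=
  map H1_row [:: [:: 2; 4]; [:: 0; 6]; [:: 0; 2; 5]].

Definition sparse_rows : seq (seq bool) := H1_row [::] :: matching_rows.

Definition clique_rows : seq (seq bool) :=
  map H1_row
    [:: iota 0 7; [:: 1]; [:: 1; 2; 4]; [:: 3; 5]; [:: 0; 3; 5];
        [:: 2; 3; 5]; [:: 3; 4; 5]; [:: 0; 1; 6]; [:: 0; 2; 4; 6];
        [:: 3; 4; 6]; [:: 0; 3; 4; 6]; [:: 2; 3; 4; 6]; [:: 3; 5; 6];
        [:: 3; 4; 5; 6]].

Fixpoint bitseqs (n : nat) : seq (seq bool) :=
  if n is m.+1 then [seq b :: l | b <- [:: true; false], l <- bitseqs m]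
  else [:: [::]].

Lemma mem_bitseqs (l : seq bool) : l \in bitseqs (size l).
Proof. by elim: l => // b l; apply: allpairs_f; case: b. Qed.

Lemma free_vertex_rows :
  all (fun r => free_vertex r ==> (r \in sparse_rows ++ clique_rows))
      (bitseqs 7).
Proof. by vm_compute. Qed.

Lemma free_pair_sparse : all (fun r => ~~ free_pair r r true) sparse_rows.
Proof. by vm_compute. Qed.

Lemma free_triple_matching :
  all (fun r =>
    all (fun s => ~~ free_triple r s s true true false) matching_rows)
    matching_rows.
Proof. by vm_compute. Qed.

Lemma free_triple_split :
  ~~ free_triple (H1_row [:: 0; 6]) (H1_row [:: 2; 4]) (H1_row [:: 2; 4])
       false false false.
Proof. by vm_compute. Qed.

Lemma free_pair_empty :
  all (fun r => free_pair (H1_row [::]) r true ==> (r == H1_row [:: 0; 2; 5]))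
      sparse_rows.
Proof. by vm_compute. Qed.

Lemma free_triple_empty :
  ~~ free_triple (H1_row [::]) (H1_row [:: 0; 2; 5]) (H1_row [:: 0; 2; 5])
       true true false.
Proof. by vm_compute. Qed.

(* A pair [(I, L)] stands for the vertices of [H1] with index in [I] together
   with the other vertices whose row is [H1_row l] for some [l] in [L]. *)
Definition vertex_class : Type := (seq nat * seq (seq nat))%type.

Definition class_rows (c : vertex_class) : seq (seq bool) := map H1_row c.2.

Definition clique_class (c : vertex_class) : bool :=
  [&& all (fun i => all (fun j => (i == j) || row_edge H1_rows i j) c.1) c.1,
      all (fun i => all (fun r => nth false r i) (class_rows c)) c.1
    & all (fun r => all (fun s => ~~ free_pair r s false) (class_rows c))
          (class_rows c)].

Definition covers_row (cs : seq vertex_class) (r : seq bool) : bool :=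
  has (fun c => r \in class_rows c) cs.

Definition covers_H1 (cs : seq vertex_class) : bool :=
  all (fun i => has (fun c : vertex_class => i \in c.1) cs) (iota 0 7).

(* No five clique classes cover [H1] and all of [clique_rows]: the covers below
   are for graphs without a vertex of row {v4, a1, a2}, without one of row
   {v4, a2, a3}, and with both. *)
Definition cover_without_v4a1a2 : seq vertex_class :=
  [:: ([:: 1; 2], [:: [:: 1; 2; 4]; iota 0 7]);
      ([:: 0; 3], [:: [:: 0; 3; 4; 6]]);
      ([::], [:: [:: 1]; [:: 3; 5; 6]; [:: 3; 4; 6]; [:: 2; 3; 4; 6];
                 [:: 3; 4; 5; 6]]);
      ([::], [:: [:: 3; 5]; [:: 2; 3; 5]; [:: 0; 1; 6]; [:: 0; 3; 5];
                 [:: 0; 2; 4; 6]]);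
      ([:: 4; 5; 6], [::])].

(* The automorphism of [H1] that exchanges v1 and v3, and a1 and a3. *)
Definition H1_mirror : nat -> nat := nth 0 [:: 2; 1; 0; 3; 6; 5; 4].

Definition cover_without_v4a2a3 : seq vertex_class :=
  [seq (map H1_mirror c.1, map (map H1_mirror) c.2)
  | c <- cover_without_v4a1a2].

Definition cover_with_both : seq vertex_class :=
  [:: ([:: 0; 1], [:: iota 0 7]);
      ([:: 2; 6], [::]);
      ([:: 4; 5], [:: [:: 3; 4; 5]]);
      ([::], [:: [:: 1]; [:: 3; 5; 6]]);
      ([:: 3], [:: [:: 3; 5]; [:: 0; 3; 5]; [:: 2; 3; 5]])].

Definition five_class_covers : seq (seq vertex_class) :=
  [:: cover_without_v4a1a2; cover_without_v4a2a3; cover_with_both].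

Lemma five_class_covers_correct :
  all (fun cs => [&& size cs == 5, all clique_class cs & covers_H1 cs])
      five_class_covers.
Proof. by vm_compute. Qed.

Lemma covers_row_without_v4a1a2 :
  all (fun r => (r != H1_row [:: 3; 4; 5]) ==>
                covers_row cover_without_v4a1a2 r) clique_rows.
Proof. by vm_compute. Qed.

Lemma covers_row_without_v4a2a3 :
  all (fun r => (r != H1_row [:: 3; 5; 6]) ==>
                covers_row cover_without_v4a2a3 r) clique_rows.
Proof. by vm_compute. Qed.

Definition compatible_rows (r s : seq bool) : bool :=
  (r == s) || has (free_pair r s) [:: true; false].

Lemma covers_row_with_both :
  all (fun r => compatible_rows r (H1_row [:: 3; 4; 5]) &&
                compatible_rows r (H1_row [:: 3; 5; 6]) ==>
                covers_row cover_with_both r) clique_rows.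
Proof. by vm_compute. Qed.

Lemma free_adj_rows (G : sgraph) (s : seq G) :
  ~ has_induced G P2_P3 -> ~ has_induced G (compl P2_P3) ->
  ~ has_induced G K2_K3 ->
  uniq s -> free_rows (adj_rows (@adj G) s).
Proof.
move=> P2_P3_free co_P2_P3_free K2_K3_free us.
have uP : uniq P2_P3_vertices by [].
apply/hasPn=> pattern; rewrite !inE => /or3P[] /eqP->;
  apply/negP=> /(contains_adj_rows us).
- by move/(has_inducedP G uP mem_P2_P3_vertices).
- by move/(@has_inducedP G (compl P2_P3) _ uP mem_P2_P3_vertices).
by move/(@has_inducedP G K2_K3 _ uP mem_P2_P3_vertices).
Qed.

Section CopyOfH1.
Variables (G : sgraph) (x0 : G) (copy : seq G).
Hypothesis free_G :
  forall s : seq G, uniq s -> free_rows (adj_rows (@adj G) s).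
Hypothesis copy_uniq : uniq copy.
Hypothesis copy_rows : adj_rows (@adj G) copy = H1_rows.

Definition trace (x : G) : seq bool := map (adj x) copy.

Lemma size_copy : size copy = 7.
Proof. by rewrite -(size_adj_rows (@adj G)) copy_rows. Qed.

Lemma nth_trace x i : i < 7 -> nth false (trace x) i = adj x (nth x0 copy i).
Proof. by move=> lti; rewrite (nth_map x0) ?size_copy. Qed.

Lemma adj_copy i j : i < 7 -> j < 7 ->
  adj (nth x0 copy i) (nth x0 copy j) = row_edge H1_rows i j.
Proof.
by move=> lti ltj; rewrite -copy_rows (row_edge_adj_rows x0) ?size_copy.
Qed.

Lemma free_vertex_trace x : x \notin copy -> free_vertex (trace x).
Proof.
by move=> xN; rewrite /free_vertex -copy_rows (@free_G (x :: copy)) //= xN.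
Qed.

Lemma free_pair_trace x y : x \notin copy -> y \notin copy -> x != y ->
  free_pair (trace x) (trace y) (adj x y).
Proof.
move=> xN yN xy; rewrite /free_pair -copy_rows (@free_G [:: x, y & copy]) //=.
by rewrite inE negb_or xy xN yN.
Qed.

Lemma free_triple_trace x y z :
  x \notin copy -> y \notin copy -> z \notin copy -> uniq [:: x; y; z] ->
  free_triple (trace x) (trace y) (trace z) (adj x y) (adj x z) (adj y z).
Proof.
move=> xN yN zN; rewrite /free_triple -copy_rows /= !inE negb_or andbT.
case/andP=> /andP[xy xz] yz; rewrite (@free_G [:: x, y, z & copy]) //=.
by rewrite !inE !negb_or xy xz yz xN yN zN.
Qed.

Lemma trace_rows x : x \notin copy -> trace x \in sparse_rows ++ clique_rows.
Proof.
move=> /free_vertex_trace free_x; have := mem_bitseqs (trace x).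
by rewrite size_map size_copy => /(allP free_vertex_rows)/implyP; apply.
Qed.

Definition sparse_part : {set G} :=
  [set x | (x \notin copy) && (trace x \in sparse_rows)].

Lemma sparse_partP x :
  reflect (x \notin copy /\ trace x \in sparse_rows) (x \in sparse_part).
Proof. by rewrite [x \in sparse_part]inE; apply: andP. Qed.

Lemma sparse_part_trace_neq x y : x \in sparse_part -> y \in sparse_part ->
  adj x y -> trace x != trace y.
Proof.
case/sparse_partP=> xN xs /sparse_partP[yN _] xy.
apply: contraTneq (free_pair_trace xN yN (adj_neq xy)) => <-; rewrite xy.
exact: allP free_pair_sparse _ xs.
Qed.

Lemma free_triple_twins x y z :
  x \in sparse_part -> y \in sparse_part -> z \in sparse_part ->
  x != y -> x != z -> y != z -> trace y = trace z ->
  free_triple (trace x) (trace y) (trace y) (adj x y) (adj x z) false.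
Proof.
move=> xs ys zs xy xz yz tyz.
have <- : adj y z = false.
  by apply: contra_eqF tyz; apply: sparse_part_trace_neq.
rewrite [in X in free_triple _ _ X]tyz.
have [[xN _] [yN _] [zN _]] :=
  And3 (sparse_partP _ xs) (sparse_partP _ ys) (sparse_partP _ zs).
by apply: free_triple_trace; rewrite //= !inE negb_or xy xz yz.
Qed.

Lemma matching_coloring_trace (W : {set G}) : W \subset sparse_part ->
  {in W, forall x, trace x \in matching_rows} -> matching_coloring trace W.
Proof.
move=> /subsetP sW matching_W; split=> [x y /sW xs /sW|x y z xW yW zW xy xz yz].
  exact: sparse_part_trace_neq.
apply/eqP=> tyz; have := free_triple_twins (sW x xW) (sW y yW) (sW z zW)
  (adj_neq xy) (adj_neq xz) yz tyz.
rewrite xy xz; apply/negP.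
exact: allP (allP free_triple_matching _ (matching_W x xW)) _ (matching_W y yW).
Qed.

Lemma trace_matching_rows (W : {set G}) x : W \subset sparse_part -> x \in W ->
  ~~ simplicial W x -> trace x \in matching_rows.
Proof.
move=> /subsetP sW xW /non_simplicialP[y [z [yW zW [xy xz yz _]]]].
case/sparse_partP: (sW x xW) => xN; rewrite inE => /predU1P[tx|//].
have trace_nbr u : u \in W -> adj x u -> trace u = H1_row [:: 0; 2; 5].
  move=> /sW/sparse_partP[uN us] xu.
  apply/eqP/(implyP (allP free_pair_empty _ us)).
  by rewrite -tx -xu free_pair_trace ?adj_neq.
have := free_triple_twins (sW x xW) (sW y yW) (sW z zW)
  (adj_neq xy) (adj_neq xz) yz.
rewrite (trace_nbr y) // (trace_nbr z) // xy xz tx.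
by rewrite (negbTE free_triple_empty) => /(_ erefl).
Qed.

Lemma sparse_part_split (W : {set G}) : W \subset sparse_part ->
  {in color_class trace W (H1_row [:: 2; 4]) &
      color_class trace W (H1_row [:: 2; 4]) &
      color_class trace W (H1_row [:: 0; 6]),
    forall x y z, x != y -> adj z x || adj z y}.
Proof.
move=> /subsetP sW x y z; rewrite !inE.
move=> /andP[/sW xs /eqP tx] /andP[/sW ys /eqP ty] /andP[/sW zs /eqP tz] xy.
have neq_z u : trace u = H1_row [:: 2; 4] -> z != u.
  by move=> tu; apply/eqP=> zu; rewrite -zu tz in tu.
have := free_triple_twins zs xs ys (neq_z x tx) (neq_z y ty) xy.
rewrite tx ty tz => /(_ erefl); apply: contraTT.
rewrite negb_or => /andP[/negbTE-> /negbTE->].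
exact: free_triple_split.
Qed.

Lemma theta_le_alpha_sparse_part : theta_le_alpha sparse_part.
Proof.
apply: simplicial_elimination => W sW nW.
have matching_W : {in W, forall x, trace x \in matching_rows}.
  by move=> x xW; apply: trace_matching_rows sW xW (nW x xW).
exact: (theta_le_alpha_non_simplicial (matching_coloring_trace sW matching_W)
          _ matching_W nW _ _ _ (sparse_part_split sW)).
Qed.

Definition class_set (c : vertex_class) : {set G} :=
  [set x | if x \in copy then index x copy \in c.1
           else trace x \in class_rows c].

Lemma clique_class_set c : clique_class c -> clique (class_set c).
Proof.
have idx x : x \in copy -> index x copy < 7 by rewrite -size_copy index_mem.
case/and3P=> /allP cI /allP cIL /allP cL; apply/cliqueP=> x y.
rewrite !inE; case: ifPn => xN xc; case: ifPn => yN yc xy.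
- have /allP/(_ _ yc)/predU1P[/index_inj eqxy|] := cI _ xc.
    by rewrite eqxy // eqxx in xy.
  by rewrite -adj_copy ?idx // !nth_index.
- have /allP/(_ _ yc) := cIL _ xc.
  by rewrite nth_trace ?idx // nth_index // adj_sym.
- have /allP/(_ _ xc) := cIL _ yc.
  by rewrite nth_trace ?idx // nth_index.
apply: contraTT (free_pair_trace xN yN xy) => /negbTE->.
by have /allP/(_ _ yc) := cL _ xc.
Qed.

Lemma compatible_rows_trace x y : x \notin copy -> y \notin copy ->
  compatible_rows (trace x) (trace y).
Proof.
move=> xN yN; have [->|xy] := eqVneq x y.
  by rewrite /compatible_rows eqxx.
apply/orP; right; apply/hasP; exists (adj x y); first by case: (adj x y).
exact: free_pair_trace.
Qed.

Lemma five_class_cover_trace : exists2 cs, cs \in five_class_covers &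
  forall x, x \notin copy -> trace x \in clique_rows -> covers_row cs (trace x).
Proof.
pose has_row r := [exists y, (y \notin copy) && (trace y == r)].
have [/existsP[y /andP[yN /eqP ty]]|/existsPn no_y] :=
  boolP (has_row (H1_row [:: 3; 4; 5])); last first.
  exists cover_without_v4a1a2; rewrite ?inE // => x xN.
  move/(allP covers_row_without_v4a1a2)/implyP; apply.
  by have := no_y x; rewrite xN.
have [/existsP[z /andP[zN /eqP tz]]|/existsPn no_z] :=
  boolP (has_row (H1_row [:: 3; 5; 6])); last first.
  exists cover_without_v4a2a3; rewrite ?inE ?eqxx ?orbT // => x xN.
  move/(allP covers_row_without_v4a2a3)/implyP; apply.
  by have := no_z x; rewrite xN.
exists cover_with_both; rewrite ?inE ?eqxx ?orbT // => x xN.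
move/(allP covers_row_with_both)/implyP; apply.
by rewrite -ty -tz !compatible_rows_trace.
Qed.

Lemma clique_coverable_compl_sparse_part : clique_coverable 5 (~: sparse_part).
Proof.
have [cs cs_in cs_rows] := five_class_cover_trace.
have /and3P[/eqP cs5 cs_clique cs_H1] := allP five_class_covers_correct _ cs_in.
exists (map class_set cs); split; rewrite ?size_map ?cs5 //.
  by rewrite all_map; apply: sub_all cs_clique; apply: clique_class_set.
move=> x; rewrite in_setC has_map => /sparse_partP xns.
have [xN|xN] := boolP (x \in copy).
  have /(allP cs_H1) : index x copy \in iota 0 7.
    by rewrite mem_iota -size_copy index_mem.
  by apply: sub_has => c; rewrite /= inE xN.
have := trace_rows xN; rewrite mem_cat => /orP[xs|/(cs_rows _ xN)].
  by case: xns.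
by apply: sub_has => c; rewrite /= inE (negbTE xN).
Qed.

Lemma stability_number_sparse_part (X : {set G}) :
  X \subset sparse_part -> stable X -> #|X| + 2 <= stability_number G.
Proof.
move=> /subsetP sX stX; pose v2 := nth x0 copy 1; pose v4 := nth x0 copy 3.
have v24 : ~~ adj v2 v4 by rewrite adj_copy.
have nv2v4 x : x \in X -> (~~ adj v2 x) * (~~ adj v4 x).
  case/sX/sparse_partP=> _ xs; rewrite ![adj _ x]adj_sym -!nth_trace //.
  split; first exact: (allP (_ : all (fun r => ~~ nth false r 1) sparse_rows)).
  exact: (allP (_ : all (fun r => ~~ nth false r 3) sparse_rows)).
have disj : [disjoint [set v2; v4] & X].
  rewrite disjoints_subset; apply/subsetP=> v v24v; rewrite inE.
  apply: contraL v24v => /sX/sparse_partP[vN _]; rewrite !inE.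
  by apply/norP; split; apply: contraNneq vN => ->; rewrite mem_nth ?size_copy.
have <- : #|[set v2; v4] :|: X| = #|X| + 2.
  rewrite cardsU disjoint_setI0 // cards0 subn0 cards2 addnC.
  by rewrite nth_uniq ?size_copy.
apply/leq_stability_number/stableU => //; first exact: stable2.
by move=> v x /set2P[]-> /nv2v4[].
Qed.

End CopyOfH1.

Theorem theorem3p2 (G : sgraph) :
  ~ has_induced G P2_P3 ->
  ~ has_induced G (compl P2_P3) ->
  ~ has_induced G K2_K3 ->
  has_induced G H1 ->
  clique_cover_number G <= stability_number G + 3.
Proof.
move=> P2_P3_free co_P2_P3_free K2_K3_free.
have free_G (s : seq G) : uniq s -> free_rows (adj_rows (@adj G) s).
  exact: free_adj_rows.
have uH1 : uniq H1_vertices by [].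
case/(has_inducedP G uH1 mem_H1_vertices)=> [[|x0 copy]] // copy_uniq copy_rows.
have [X [sX stX covX]] :=
  theta_le_alpha_sparse_part free_G copy_uniq copy_rows.
have cov5 := clique_coverable_compl_sparse_part x0 free_G copy_uniq copy_rows.
have alphaX := stability_number_sparse_part x0 copy_uniq copy_rows sX stX.
apply: (@leq_trans (#|X| + 5)); last by rewrite -[5]/(2 + 3) addnA leq_add2r.
apply: clique_cover_number_le; rewrite -(setUCr (sparse_part (x0 :: copy))).
exact: clique_coverableU covX cov5.
Qed.
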